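(* Let $n\in\mathbb{Z}_+^d$ be a prebasis, $N=\prod_{i=1}^d n[i]$, let $A$ be a $d\times d'$ natural number matrix all of whose rows contain a positive integer, and let $N'=\prod_{i=1}^{d'}n^A[i]$. The maps $\mathrm{tess}_n$ and $\mathrm{diag}_n$ are inverse maps of each other. For any $z\in\mathbb{Z}^d$ the system $(\Sigma_{N'}^{\mathbb{Z}},\Pi_{\alpha(z,n),N'})$ is conjugate to $(X_{n^A},\sigma_{A,z})$ via $\mathrm{tess}_{n^A}$, and $(\Sigma_N^{\mathbb{Z}},\Pi_{\alpha(z,n),N})$ is conjugate to $(X_n,\sigma_z)$ via $\mathrm{tess}_n$.
   Context: **Dynamics.** A dynamical system $(X,T)$ is a compact metrizable space $X$ with a continuous $T:X\to X$. $(X,T)$ and $(Y,S)$ are conjugate via $\psi$ if $\psi:X\to Y$ is a continuous bijection with $\psi\circ T=S\circ\psi$. $\mathbb{N}=\{0,1,2,\dots\}$, $\Sigma_N=\{0,\dots,N-1\}$; function spaces $A^B$ with $A$ finite, $B$ countable carry the prodiscrete topology. $\sigma_z(f)[z']=f[z'+z]$. **Multiplication automata.** For $p$ dividing $N$ with $N=pq$, $\Pi_{p,N}:\Sigma_N^{\mathbb{Z}}\to\Sigma_N^{\mathbb{Z}}$ is $\Pi_{p,N}(x)[i]=g_{p,N}(x[i],x[i+1])$, where $g_{p,N}(a_1q+a_0,b_1q+b_0)=a_0p+b_1$ for $a_0,b_0\in\Sigma_q$, $a_1,b_1\in\Sigma_p$. These maps are bijective and commute. If $\alpha=p/q$ with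 $p=\prod p_i$, $q=\prod q_j$ products of positive divisors $p_i,q_j$ of $N$, then $\Pi_{\alpha,N}$ is the composition of the maps $\Pi_{p_i,N}$ and $\Pi_{q_j,N}^{-1}$ (independent of the decomposition). **Cubes.** Vectors are ordered coordinatewise; $\mathbf{k}=(k,\dots,k)$; $e_i$ are the standard basis vectors. A prebasis of dimension $d$ is $n\in\mathbb{Z}_+^d$; put $m(n,v)=\prod_{j=1}^d n[j]^{-v[j]}$ for $v\in\mathbb{Z}^d$ and $N=\prod_in[i]$. For $a\in\mathbb{N}$ and $\mathbf{0}\ge v_1\ge v_2$ in $\mathbb{Z}^d$, $\mathrm{base}_n(a,(v_1,v_2))[2]$ denotes the integer $a_1$ in the unique representation $a=a_0+a_1m(n,v_1)+a_2m(n,v_2)$ with $0\le a_0<m(n,v_1)$, $0\le a_1<m(n,v_2)/m(n,v_1)$, $a_2\ge0$. For $a\in\Sigma_N$, $\mathrm{cube}_n(a)$ is the function on pairs $v_1\ge v_2$ in $\{-1,0\}^d$ given by $\mathrm{cube}_n(a)[v_1,v_2]=\mathrm{base}_n(a,(v_1,v_2))[2]$. $T_n=\{\mathrm{cube}_n(a):a\in\Sigma_N\}$, $\mathrm{val}_n(t)=t[\mathbf{0},-\mathbf{1}]$ (so $\mathrm{val}_n(\mathrm{cube}_n(a))=a$). $X_n$ is the set of $f:\mathbb{Z}^d\to T_n$ such that $f[z][\mathbf{0},-\mathbf{1}+e_i]=f[z+e_i][-e_i,-\mathbf{1}]$ for all $z\in\mathbb{Z}^d$, $1\le i\le d$. **Labels.**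 For $f\in X_n$, the edge $\{z-e_i,z\}$ has label $\lambda(f,\{z-e_i,z\})=f[z][\mathbf{0},-e_i]$. If $p'-p=ae_j$ with $a=\pm1$, $(p,p')f=a\,m(n,\max\{p,p'\})\lambda(f,\{p,p'\})$. For general $p,p'\in\mathbb{Z}^d$, $(p,p')f=\sum_i(P_i,P_{i+1})f$ over any path of unit steps from $p$ to $p'$ (independent of the path), and $\lambda(f,(p,p'))=(p,p')f/m(n,p')$. **Macrotile and microtile maps.** $n^A\in\mathbb{Z}_+^{d'}$ is $n^A[i]=m(n,-Ae_i)$, and $\mathrm{M}_{A}:X_n\to X_{n^A}$ is $\mathrm{M}_{A}(f)[v]=\mathrm{cube}_{n^A}(\lambda(f,(A(v-\mathbf{1}),Av)))$ for $v\in\mathbb{Z}^{d'}$. $\mu_{A}:X_{n^A}\to X_n$ is defined as follows: for $f\in X_{n^A}$, $x\in\mathbb{Z}^d$ choose $z_1\in\mathbb{Z}^{d'}$ with $v:=Az_1-x\ge\mathbf{0}$ and $z_2\le z_1$ with $Az_2\le x-\mathbf{1}$, let $a=\lambda(f,(z_2,z_1))\in\mathbb{N}$, and put $\mu_{A}(f)[x]=\mathrm{cube}_n(\mathrm{base}_n(a,(-v,-v-\mathbf{1}))[2])$ (independent of choices; the result is in $X_n$; $\mu_A$ is the inverse of $\mathrm{M}_A$). For $z\in\mathbb{Z}^d$, $\sigma_{A,z}:X_{n^A}\to X_{n^A}$ is $\sigma_{A,z}=\mathrm{M}_A\circ\sigma_z\circ\mu_A$. **Tessellations and configurations.** For a prebasis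 $n$ of dimension $d$ with $N=\prod_i n[i]$ and $z\in\mathbb{Z}^d$, $\alpha(z,n)=\prod_{i=1}^d n[i]^{z[i]}$. $\mathrm{tess}_n:\Sigma_N^{\mathbb{Z}}\to X_n$ is $\mathrm{tess}_n(x)[z]=\mathrm{cube}_n(\Pi_{\alpha(z,n),N}(x)[0])$ (this is indeed in $X_n$); $\mathrm{diag}_n:X_n\to\Sigma_N^{\mathbb{Z}}$ is $\mathrm{diag}_n(f)[i]=\mathrm{val}_n(f[\mathbf{i}])$. *)

(* Defs.v *)
From HB Require Import structures.
From mathcomp Require Import all_boot all_order all_algebra.
From mathcomp Require Import all_classical all_reals all_analysis.

Set Implicit Arguments.
Unset Strict Implicit.
Unset Printing Implicit Defensive.

Import Order.TTheory GRing.Theory Num.Theory.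
Local Open Scope classical_set_scope.
Local Open Scope ring_scope.

Definition metrizable (R : realType) (T : topologicalType) : Prop :=
  exists dist : T -> T -> R,
    [/\ forall x y, dist x y = 0 <-> x = y,
        forall x y, dist x y = dist y x,
        forall x y z, dist x z <= dist x y + dist y z &
        forall (x : T) (U : set T),
          nbhs x U <-> exists2 e : R, 0 < e & [set y | dist x y < e] `<=` U].

(* A space is given as a subset [X] of an ambient topological space, with the
   subspace topology; maps are defined on the ambient type and only their
   restriction to [X] is relevant. *)
Definition dynamical_system (R : realType) (T : topologicalType)
    (X : set T) (F : T -> T) : Prop :=
  [/\ compact X, metrizable R (set_type X), set_fun X X F &
      {within X, continuous F}].

Definition conjugate_via (R : realType) (T U : topologicalType)
    (X : set T) (F : T -> T) (Y : set U) (G : U -> U) (psi : T -> U) : Prop :=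
  [/\ dynamical_system R X F, dynamical_system R Y G, set_bij X Y psi,
      {within X, continuous psi} & forall x, X x -> psi (F x) = G (psi x)].

Definition inverse_maps (T U : Type) (X : set T) (Y : set U)
    (f : T -> U) (g : U -> T) : Prop :=
  [/\ set_fun X Y f, set_fun Y X g,
      forall x, X x -> g (f x) = x & forall y, Y y -> f (g y) = y].

(* [nat] is discrete in the library and [Sigma N] has values below [N], so
   its subspace topology is the prodiscrete topology of Sigma_N^Z. *)
Notation config := {ptws int -> nat}.

Definition Sigma (N : nat) : set config := [set x | forall i, (x i < N)%N].

Definition mul_rule (p N a b : nat) : nat :=
  let q := (N %/ p)%N in ((a %% q) * p + b %/ q)%N.

Lemma mul_ruleE (p q a1 a0 b1 b0 : nat) :
  (0 < p)%N -> (a0 < q)%N -> (b0 < q)%N ->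
  mul_rule p (p * q) (a1 * q + a0) (b1 * q + b0) = (a0 * p + b1)%N.
Proof.
move=> p0 a0q b0q; rewrite /mul_rule mulKn// modnMDl modn_small//.
by rewrite divnMDl ?(leq_ltn_trans _ b0q)// divn_small// addn0.
Qed.

Definition mul_ca (p N : nat) (x : config) : config :=
  fun i => mul_rule p N (x i) (x (i + 1)).

Definition mul_ca_inv (p N : nat) (y : config) : config :=
  xget y [set x | Sigma N x /\ mul_ca p N x = y].

Definition mul_ca_comp (N : nat) (ps qs : seq nat) (x : config) : config :=
  foldr (mul_ca^~ N) (foldr (mul_ca_inv^~ N) x qs) ps.

Definition fraction_of (N : nat) (alpha : rat) : set (seq nat * seq nat) :=
  [set D | [/\ forall p, p \in D.1 -> (0 < p)%N && (p %| N)%N,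
               forall q, q \in D.2 -> (0 < q)%N && (q %| N)%N &
               alpha = (\prod_(p <- D.1) p%:R) / (\prod_(q <- D.2) q%:R)]].

(* The map does not depend on the decomposition, so an arbitrary one is
   chosen. *)
Definition mul_ca_rat (N : nat) (alpha : rat) (x : config) : config :=
  let D := xget ([::], [::]) (fraction_of N alpha) in mul_ca_comp N D.1 D.2 x.

Definition vle (d : nat) (u v : 'cV[int]_d) : bool :=
  [forall i, u i 0 <= v i 0].

Definition e_ (d : nat) (i : 'I_d) : 'cV[int]_d := delta_mx i 0.

Definition pre_prod (d : nat) (n : 'I_d -> nat) : nat := (\prod_i n i)%N.

Definition mval (d : nat) (n : 'I_d -> nat) (v : 'cV[int]_d) : rat :=
  \prod_j (n j)%:R ^ (- v j 0).

(* The digit a_1 of a = a_0 + a_1 m(n,v_1) + a_2 m(n,v_2); see [base_digitP]. *)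
Definition base_digit (d : nat) (n : 'I_d -> nat) (a : nat)
    (v1 v2 : 'cV[int]_d) : nat :=
  let m1 := Num.truncn (mval n v1) in
  let m2 := Num.truncn (mval n v2) in
  ((a %/ m1) %% (m2 %/ m1))%N.

Lemma mval_gt0 (d : nat) (n : 'I_d -> nat) (v : 'cV[int]_d) :
  (forall i, (0 < n i)%N) -> 0 < mval n v.
Proof. by move=> n0; apply: prodr_gt0 => j _; rewrite exprz_gt0// ltr0n. Qed.

Lemma mvalB (d : nat) (n : 'I_d -> nat) (u v : 'cV[int]_d) :
  (forall i, (0 < n i)%N) -> mval n (u - v) = mval n u / mval n v.
Proof.
move=> n0; rewrite /mval -prodf_div; apply: eq_bigr => j _.
by rewrite !mxE opprB addrC expfzDr ?invr_expz ?pnatr_eq0 -?lt0n// !opprK.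
Qed.

Lemma mval_nat (d : nat) (n : 'I_d -> nat) (v : 'cV[int]_d) :
  vle v 0 -> mval n v = (Num.truncn (mval n v))%:R.
Proof.
move=> v0; suff [k ->] : exists k : nat, mval n v = k%:R.
  by rewrite natrK.
exists (\prod_j n j ^ `|v j 0%R|)%N; rewrite natr_prod; apply: eq_bigr => j _.
have vj : v j 0 <= 0 by move/forallP: v0 => /(_ j); rewrite mxE.
rewrite natrX.
by rewrite -[- v j 0]gez0_abs ?oppr_ge0// abszN.
Qed.

Lemma base_digitP (d : nat) (n : 'I_d -> nat) (a : nat)
    (v1 v2 : 'cV[int]_d) (a1 : nat) :
  (forall i, (0 < n i)%N) -> vle v1 0 -> vle v2 v1 ->
  base_digit n a v1 v2 = a1 <->
  exists a0 a2 : nat,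
    [/\ a%:R = a0%:R + a1%:R * mval n v1 + a2%:R * mval n v2 :> rat,
        a0%:R < mval n v1 & a1%:R < mval n v2 / mval n v1].
Proof.
move=> n0 v10 v21.
have v20 : vle v2 0.
  apply/forallP => i; move/forallP/(_ i): v21 => /le_trans; apply.
  exact: (forallP v10 i).
have v210 : vle (v2 - v1) 0.
  by apply/forallP => i; rewrite !mxE subr_le0; exact: (forallP v21 i).
have m1P := mval_nat n v10; have m2P := mval_nat n v20.
have := mval_nat n v210; rewrite mvalB// => kP.
have := mval_gt0 v1 n0; have := mval_gt0 v2 n0.
rewrite /base_digit.
move: (Num.truncn (mval n v1)) (Num.truncn (mval n v2)) m1P m2P kP.
move: (Num.truncn _) => k m1 m2 -> -> kP; rewrite !ltr0n => m20 m10.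
have m2k : m2 = (k * m1)%N.
  apply/eqP; rewrite -(eqr_nat rat) natrM -kP divfK//.
  by rewrite pnatr_eq0 -lt0n.
rewrite kP m2k mulnK//.
have k0 : (0 < k)%N by move: m20; rewrite m2k muln_gt0 => /andP[].
split=> [<-|[a0 [a2 []]]].
  exists (a %% m1)%N, (a %/ m1 %/ k)%N; rewrite !ltr_nat !ltn_mod; split=> //.
  rewrite -!natrM -!natrD; congr (_%:R).
  rewrite mulnA -addnA -mulnDl addnC [in X in (X * m1)%N]addnC -divn_eq.
  by rewrite -divn_eq.
rewrite -!natrM -!natrD !ltr_nat => /eqP; rewrite eqr_nat => /eqP -> a0m a1k.
rewrite -addnA mulnA -mulnDl divnDMl// divn_small// add0n addnC modnMDl.
by rewrite modn_small.
Qed.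

(* The vertices of {-1,0}^d are encoded by the sets V of coordinates equal to
   -1, so that v1 >= v2 is inclusion of the corresponding sets. *)
Definition vertex (d : nat) (V : {set 'I_d}) : 'cV[int]_d :=
  - \sum_(i in V) e_ i.

Definition face (d : nat) : Type :=
  {V : {set 'I_d} * {set 'I_d} | V.1 \subset V.2}.
HB.instance Definition _ (d : nat) := Finite.on (face d).

(* The pairs (0, v), resp. (v, -1), where v is the vertex encoded by V. *)
Definition face0 (d : nat) (V : {set 'I_d}) : face d :=
  exist _ (finset.set0, V) (finset.sub0set V).
Definition face1 (d : nat) (V : {set 'I_d}) : face d :=
  exist _ (V, [set: 'I_d]%SET) (finset.subsetT V).

Notation cube_type d := (discrete_topology {ffun face d -> nat}).

Definition cube (d : nat) (n : 'I_d -> nat) (a : nat) : cube_type d :=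
  [ffun F : face d => base_digit n a (vertex (val F).1) (vertex (val F).2)].

Definition entry (d : nat) (t : cube_type d) (F : face d) : nat :=
  (t : {ffun face d -> nat}) F.

Definition cubes (d : nat) (n : 'I_d -> nat) : set (cube_type d) :=
  [set cube n a | a in [set a | (a < pre_prod n)%N]].

Definition cube_val (d : nat) (t : cube_type d) : nat :=
  entry t (face0 [set: 'I_d]%SET).

Notation tiling d := {ptws 'cV[int]_d -> cube_type d}.

Definition Xspace (d : nat) (n : 'I_d -> nat) : set (tiling d) :=
  [set f | (forall z, cubes n (f z)) /\
     forall (z : 'cV[int]_d) (i : 'I_d),
       entry (f z) (face0 (~: [set i])%SET) =
       entry (f (z + e_ i)) (face1 [set i]%SET)].

Definition tile_shift (d : nat) (z : 'cV[int]_d) (f : tiling d) : tiling d :=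
  fun z' => f (z' + z).

(* [label f z i] is the label of the edge {z - e_i, z}. *)
Definition label (d : nat) (f : tiling d) (z : 'cV[int]_d) (i : 'I_d) : nat :=
  entry (f z) (face0 [set i]%SET).

(* A unit step (b, i) is +e_i if [b] is false and -e_i if [b] is true. *)
Definition step (d : nat) (s : bool * 'I_d) : 'cV[int]_d :=
  (-1) ^+ s.1 *: e_ s.2.

Definition step_sum (d : nat) (n : 'I_d -> nat) (f : tiling d)
    (p : 'cV[int]_d) (s : bool * 'I_d) : rat :=
  let pmax := if s.1 then p else p + e_ s.2 in
  (-1) ^+ s.1 * mval n pmax * (label f pmax s.2)%:R.

Fixpoint path_end (d : nat) (p : 'cV[int]_d) (w : seq (bool * 'I_d)) :
    'cV[int]_d :=
  if w is s :: w' then path_end (p + step s) w' else p.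

Fixpoint path_sum (d : nat) (n : 'I_d -> nat) (f : tiling d)
    (p : 'cV[int]_d) (w : seq (bool * 'I_d)) : rat :=
  if w is s :: w' then step_sum n f p s + path_sum n f (p + step s) w' else 0.

(* For f in [Xspace n] the sum is the same along all paths from p to p'. *)
Definition pair_sum (d : nat) (n : 'I_d -> nat) (f : tiling d)
    (p p' : 'cV[int]_d) : rat :=
  xget 0 [set path_sum n f p w | w in [set w | path_end p w = p']].

Definition lambda (d : nat) (n : 'I_d -> nat) (f : tiling d)
    (p p' : 'cV[int]_d) : rat :=
  pair_sum n f p p' / mval n p'.

Definition appA (d d' : nat) (A : 'M[nat]_(d, d')) (v : 'cV[int]_d') :
    'cV[int]_d :=
  map_mx Posz A *m v.

Definition pre_mx (d d' : nat) (n : 'I_d -> nat) (A : 'M[nat]_(d, d'))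
    (j : 'I_d') : nat :=
  (\prod_i n i ^ A i j)%N.

Lemma pre_mxE (d d' : nat) (n : 'I_d -> nat) (A : 'M[nat]_(d, d'))
    (j : 'I_d') :
  (pre_mx n A j)%:R = mval n (- appA A (e_ j)).
Proof.
rewrite /pre_mx natr_prod; apply: eq_bigr => i _.
by rewrite /appA /e_ -colE !mxE opprK natrX.
Qed.

(* On the relevant arguments [lambda] is a natural number, which [Num.truncn]
   reads off. *)
Definition macro (d d' : nat) (n : 'I_d -> nat) (A : 'M[nat]_(d, d'))
    (f : tiling d) : tiling d' :=
  fun v => cube (pre_mx n A)
    (Num.truncn (lambda n f (appA A (v - const_mx 1)) (appA A v))).

(* The result does not depend on the pair (z1, z2). *)
Definition micro (d d' : nat) (n : 'I_d -> nat) (A : 'M[nat]_(d, d'))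
    (f : tiling d') : tiling d :=
  fun x =>
    let z := xget (0, 0)
      [set z : 'cV[int]_d' * 'cV[int]_d' |
        [/\ vle 0 (appA A z.1 - x), vle z.2 z.1 &
            vle (appA A z.2) (x - const_mx 1)]] in
    let v := appA A z.1 - x in
    let a := Num.truncn (lambda (pre_mx n A) f z.2 z.1) in
    cube n (base_digit n a (- v) (- v - const_mx 1)).

Definition macro_shift (d d' : nat) (n : 'I_d -> nat) (A : 'M[nat]_(d, d'))
    (z : 'cV[int]_d) (f : tiling d') : tiling d' :=
  macro n A (tile_shift z (micro n A f)).

Definition alpha (d : nat) (z : 'cV[int]_d) (n : 'I_d -> nat) : rat :=
  \prod_i (n i)%:R ^ z i 0.

Definition tess (d : nat) (n : 'I_d -> nat) (x : config) : tiling d :=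
  fun z => cube n (mul_ca_rat (pre_prod n) (alpha z n) x 0).

Definition diag (d : nat) (n : 'I_d -> nat) (f : tiling d) : config :=
  fun i => cube_val (f (const_mx i)).

(* Main.v *)
Require Import Defs.
From mathcomp Require Import all_boot all_order all_algebra.
From mathcomp Require Import all_classical all_reals all_analysis.
From mathcomp Require Import zify.

(* A configuration is locally the base-N expansion of a rational r >= 0, and
   Pi_{p,N} multiplies r by p; so Pi_{alpha,N} turns the digits
   floor(r N^i) mod N into floor(alpha r N^i) mod N, and since it is local it
   is determined by this. Hence tess_n(x) is locally the tiling with cube
   floor(alpha(z) r) mod N at z. Its labels are the increments of
   z |-> floor(alpha(z) r) / alpha(z), so that path sums telescope, and both
   M_A and mu_A just rewrite the same r in another prebasis, which turns a
   translation by z into the multiplication by alpha(z). Conversely, in a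
   tiling of X_n the diagonal through z + e_i is the image under Pi_{n[i],N}
   of the diagonal through z, whence the main diagonal determines the
   tiling. *)

Set Implicit Arguments.
Unset Strict Implicit.
Unset Printing Implicit Defensive.

Import Order.TTheory GRing.Theory Num.Theory.
Local Open Scope classical_set_scope.
Local Open Scope ring_scope.

(** * Countable products of discrete spaces *)

Section discrete_product.
Context {I : countType} {T : discreteTopologicalType}.
Implicit Types (f g : {ptws I -> T}) (X : set {ptws I -> T}).

(** The product topology is a supremum of initial topologies, so convergence of the filter of finite
    cylinders to [f] need only be checked on single coordinates; it puts a cylinder inside each
    neighbourhood. *)
Lemma nbhs_ptwsP f (U : set {ptws I -> T}) :
  nbhs f U <-> exists s : seq I, forall g, {in s, g =1 f} -> U g.
Proof.
split=> [|[s sU]].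
  pose B (s : seq I) := [set g : {ptws I -> T} | {in s, g =1 f}].
  pose F := filter_from [set: seq I] B.
  have FF : Filter F.
    apply: filter_from_filter; first by exists [::].
    move=> s t _ _; exists (s ++ t) => // g gst.
    by split=> i is_; apply: gst; rewrite mem_cat is_ ?orbT.
  have : F --> f.
    apply/cvg_sup => i V [W [[Z oZ <-]] Zfi WV].
    apply: (filterS WV); exists [:: i] => // g /(_ i).
    by rewrite inE eqxx => /(_ isT) gi /=; rewrite gi.
  by move=> FU /FU[s _ sU]; exists s.
suff : nbhs f [set g : {ptws I -> T} | {in s, g =1 f}] by apply: filterS.
elim: s {sU} => [|i s IHs].
  by apply: filterS (filterT : nbhs f setT) => g _ j.
have fi : nbhs f [set g : {ptws I -> T} | g i = f i].
  exact: (@proj_continuous I (fun=> T) i f _ (discrete_set1 (f i))).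
apply: filterS (filterI fi IHs) => g [/= gi gs] j.
by rewrite inE => /predU1P[->//|]; exact: gs.
Qed.

Let agree (k : nat) f g := forall i, (pickle i < k)%N -> f i = g i.

Let le_agree k l f g : (k <= l)%N -> agree l f g -> agree k f g.
Proof. by move=> kl fg i ik; apply/fg/(leq_trans ik). Qed.

Let nbhs_agree f (U : set {ptws I -> T}) :
  nbhs f U <-> exists k, agree k f `<=` U.
Proof.
rewrite nbhs_ptwsP; split=> [[s sU]|[k kU]].
  exists (\max_(i <- s) (pickle i).+1)%N => g fg; apply: sU => i is_.
  by apply/esym/fg; rewrite (big_rem i)//= leq_max leqnn.
exists (pmap unpickle (iota 0 k)) => g gf; apply: kU => i ik; apply/esym/gf.
by rewrite mem_pmap -(pickleK i); apply: map_f; rewrite mem_iota.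
Qed.

(* The distance between distinct points is [1 / (k + 1)], where [k] is the
   code of the first coordinate at which they differ. *)
Let dist (R : realType) f g : R :=
  if pselect (exists k, ~~ `[< agree k.+1 f g >]) is left h
  then (ex_minn h).+1%:R^-1 else 0.

Let dist_ge0 (R : realType) f g : 0 <= dist R f g.
Proof. by rewrite /dist; case: pselect. Qed.

Let dist_lt (R : realType) f g k :
  dist R f g < k.+1%:R^-1 <-> agree k.+1 f g.
Proof.
rewrite /dist; case: pselect => [h|nh]; last first.
  split=> _; last by rewrite invr_gt0.
  by apply: contrapT => fg; apply: nh; exists k; apply/asboolPn.
case: ex_minnP => m /asboolPn fgm mmin.
rewrite ltf_pV2 ?posrE// ltr_nat ltnS; split=> [km|fg].
  by apply: contrapT => /asboolPn/mmin; rewrite leqNgt km.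
by rewrite ltnNge; apply/negP => mk; apply: fgm; exact: le_agree fg.
Qed.

Let distE (R : realType) f g :
  dist R f g = 0 \/ exists k, dist R f g = k.+1%:R^-1.
Proof.
by rewrite /dist; case: pselect => [h|]; [right; exists (ex_minn h)|left].
Qed.

Let dist_le (R : realType) f g f' g' :
  (forall k, agree k f' g' -> agree k f g) -> dist R f g <= dist R f' g'.
Proof.
move=> h; have [->|[k fgk]] := distE R f g; first exact: dist_ge0.
rewrite leNgt; apply/negP; rewrite fgk => /dist_lt/h/(dist_lt R).
by rewrite fgk ltxx.
Qed.

Lemma metrizable_ptws (R : realType) X : metrizable R (set_type X).
Proof.
have agreeC k f g : agree k f g -> agree k g f.
  by move=> fg i ik; rewrite fg.
exists (fun x y => dist R (val x) (val y)); split.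
- move=> x y; split=> [xy0|<-].
    apply/val_inj/funext => i.
    have /dist_lt : dist R (val x) (val y) < (pickle i).+1%:R^-1.
      by rewrite xy0 invr_gt0.
    by move=> /(_ i (ltnSn _)).
  have [//|[k xk]] := distE R (val x) (val x).
  suff : dist R (val x) (val x) < k.+1%:R^-1 by rewrite xk ltxx.
  exact/dist_lt.
- by move=> x y; apply/le_anti/andP; split; apply: dist_le => k /agreeC.
- move=> x y z; have [->|[k xzk]] := distE R (val x) (val z).
    exact: addr_ge0 (dist_ge0 _ _ _) (dist_ge0 _ _ _).
  (* Were the sum below [1 / (k + 1)], so would be both summands, and [x], [y], [z] would agree at
     all codes up to [k]. *)
  rewrite leNgt; apply/negP => xyz.
  have xzlt u v : 0 <= v -> u + v < dist R (val x) (val z) ->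
      u < k.+1%:R^-1 by rewrite xzk => v0; apply: le_lt_trans; rewrite lerDl.
  have /dist_lt xy := xzlt _ _ (dist_ge0 _ _ _) xyz.
  have /dist_lt yz : dist R (val y) (val z) < k.+1%:R^-1.
    by apply: xzlt (dist_ge0 _ (val x) (val y)) _; rewrite addrC.
  suff /(dist_lt R) : agree k.+1 (val x) (val z) by rewrite xzk ltxx.
  by move=> i ik; rewrite xy// yz.
- move=> x U; split.
    move=> [/= _ [[W oW <-] Wx WU]].
    have /nbhs_agree[k kW] : nbhs (val x : {ptws I -> T}) W.
      exact: open_nbhs_nbhs.
    exists k.+1%:R^-1; first by rewrite invr_gt0.
    move=> y /= /dist_lt xy; apply: WU; apply: kW.
    exact: le_agree xy.
  move=> [e e0 eU].
  have [k ke] : exists k : nat, k.+1%:R^-1 < e.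
    exists (Num.truncn e^-1).
    by rewrite invf_plt ?posrE// truncnS_gt.
  have xk : nbhs (val x : {ptws I -> T}) (agree k.+1 (val x)).
    by apply/nbhs_agree; exists k.+1.
  move: xk; rewrite nbhsE /= => -[W [oW Wx] Wk].
  exists (val @^-1` W); first by split=> //; exists W.
  by move=> y /= /Wk/(dist_lt R) xy; exact/eU/(lt_trans xy).
Qed.

End discrete_product.

Lemma within_continuous_ptws (I J : countType) (T S : discreteTopologicalType)
    (X : set {ptws I -> T}) (F : {ptws I -> T} -> {ptws J -> S}) :
  (forall f, X f -> forall j, exists s : seq I,
    forall g, X g -> {in s, g =1 f} -> F g j = F f j) ->
  {within X, continuous F}.
Proof.
move=> FX; apply/subspace_continuousP => f Xf U /nbhs_ptwsP[t tU].
suff [s sX] : exists s : seq I,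
    forall g, X g -> {in s, g =1 f} -> {in t, F g =1 F f}.
  rewrite /nbhs/=; apply/nbhs_ptwsP; exists s => g gf Xg.
  by apply: tU; exact: sX.
elim: t {tU} => [|j t [s IHt]]; first by exists [::].
have [u uj] := FX f Xf j; exists (u ++ s) => g Xg gf k.
rewrite inE => /predU1P[->|]; first apply: uj => // i iu.
  by apply: gf; rewrite mem_cat iu.
by apply: IHt => // i is_; apply: gf; rewrite mem_cat is_ orbT.
Qed.

(** * Multiplication automata *)

Lemma divn_truncn (x : rat) (k : nat) :
  0 <= x -> (Num.truncn x %/ k)%N = Num.truncn (x / k%:R).
Proof.
move=> x0; case: k => [|k]; first by rewrite divn0 invr0 mulr0 truncn0.
have /andP[mx xm] := truncn_itv x0; apply/esym/truncn_def.
rewrite ler_pdivlMr ?ltr_pdivrMr ?ltr0n// -!natrM.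
rewrite (le_trans _ mx) ?ler_nat ?leq_trunc_div//=.
by rewrite (lt_le_trans xm)// ler_nat ltn_ceil.
Qed.

(** Position [i] has weight [N ^ (- i)], so the left shift multiplies by [N]. *)
Definition digit (N : nat) (r : rat) (i : int) : nat :=
  (Num.truncn (r * N%:R ^ i) %% N)%N.

(** [0 <= r] is kept because [Num.truncn] is the floor only on nonnegative numbers. *)
Definition agrees_near (N : nat) (x : config) (r : rat) (i : int) (k : nat) :
    Prop :=
  0 <= r /\ forall j : int, (`|j - i| <= k)%N -> x j = digit N r j.

(* [F] is local, and on the base-[N] expansions of rationals, which are dense
   in [Sigma N], it is the multiplication by [b]. *)
Definition multiplies (N : nat) (F : config -> config) (b : rat) : Prop :=
  0 <= b /\ exists k, forall x r i,
    Sigma N x -> agrees_near N x r i k -> F x i = digit N (b * r) i.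

Lemma agrees_near_le N x r i k j l :
  (`|j - i| + l <= k)%N -> agrees_near N x r i k -> agrees_near N x r j l.
Proof. by move=> jlk [r0 xr]; split=> // m mj; apply: xr; lia. Qed.

Section multiplication_automata.
Variable (N : nat).
Hypothesis N_gt0 : (0 < N)%N.

Lemma digit_lt r i : (digit N r i < N)%N.
Proof. exact: ltn_pmod. Qed.

Let Nneq0 : N%:R != 0 :> rat.
Proof. by rewrite pnatr_eq0 -lt0n. Qed.

Lemma digitM_exp r i k : digit N (r * N%:R ^ k) i = digit N r (k + i).
Proof. by rewrite /digit -mulrA -expfzDr. Qed.

Lemma base_expansion (a : nat -> nat) (l : nat) :
  (forall j, (a j < N)%N) ->
  exists m, forall j, (j < l)%N -> ((m %/ N ^ j) %% N)%N = a j.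
Proof.
elim: l a => [|l IHl] a aN; first by exists 0%N.
have [m mP] := IHl (a \o S) (fun j => aN j.+1).
exists (m * N + a 0)%N => -[_|j jl]; first by rewrite divn1 modnMDl modn_small.
by rewrite expnS divnMA divnMDl// (divn_small (aN _)) addn0 mP.
Qed.

Lemma agrees_near_ex x i k : Sigma N x -> exists r, agrees_near N x r i k.
Proof.
(* Read from right to left, the window lists the digits of an integer [m], least significant first;
   dividing [m] by [N ^ (i + k)] puts its units digit at position [i + k]. *)
move=> xN; pose a (j : nat) := x (i + k%:Z - j%:Z).
have [m mP] := @base_expansion a (k + k).+1 (fun j => xN _).
exists (m%:R * N%:R ^ (- (i + k%:Z))); split.
  by rewrite mulr_ge0 ?exprz_ge0.
move=> j ji; have -> : x j = a (`|(i + k%:Z - j)%R|%N) by congr x; lia.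
rewrite -mP; last by lia.
rewrite digitM_exp /digit.
have -> : - (i + k%:Z) + j = - (`|(i + k%:Z - j)%R|%N : int) by lia.
by rewrite -invr_expz -exprnP -natrX -divn_truncn// natrK.
Qed.

Lemma multiplies_Sigma F b : multiplies N F b -> set_fun (Sigma N) (Sigma N) F.
Proof.
move=> [_ [k FP]] x xN i; have [r /FP->//] := agrees_near_ex i k xN.
exact: digit_lt.
Qed.

Lemma multiplies_comp F b G c : multiplies N F b -> multiplies N G c ->
  multiplies N (F \o G) (b * c).
Proof.
move=> Fb Gc; have GN := multiplies_Sigma Gc.
move: Fb Gc => [b0 [k FP]] [c0 [l GP]]; split; first exact: mulr_ge0.
exists (k + l)%N => x r i xN xr /=; rewrite -mulrA; apply: FP; first exact: GN.
split=> [|j ji]; first by apply: mulr_ge0 => //; case: xr.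
by apply: GP => //; apply: agrees_near_le xr; lia.
Qed.

Lemma multiplies_ext F G b : (forall x, Sigma N x -> F x = G x) ->
  multiplies N F b -> multiplies N G b.
Proof.
by move=> FG [b0 [k FP]]; split=> //; exists k => x r i xN; rewrite -FG//;
  exact: FP.
Qed.

(** One [r] matches [x] on a window large enough for both maps. Identities between automata thus
    reduce to identities between rationals. *)
Lemma multiplies_inj F G b x : multiplies N F b -> multiplies N G b ->
  Sigma N x -> F x = G x.
Proof.
move=> [_ [k FP]] [_ [l GP]] xN; apply/funext => i.
have [r xr] := agrees_near_ex i (k + l) xN.
by rewrite (FP _ r)// ?(GP _ r)//; apply: agrees_near_le xr; lia.
Qed.

Lemma multiplies_shift k : multiplies N (fun x i => x (i + k)) (N%:R ^ k).
Proof.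
split; first by rewrite exprz_ge0.
exists `|k|%N => x r i xN [r0 xr]; rewrite xr; last by lia.
by rewrite mulrC digitM_exp addrC.
Qed.

Lemma multiplies_id : multiplies N id 1.
Proof.
by apply: multiplies_ext (multiplies_shift 0) => x _; apply/funext => i;
  rewrite addr0.
Qed.

(** Divide the digit on the right by [p]: its quotient comes from the left digit of [t], its
    remainder from the right one. *)
Lemma mul_rule_divn p q t : (0 < p)%N ->
  mul_rule p (p * q) ((t %/ (p * q)) %% (p * q)) (t %% (p * q)) =
  ((t %/ q) %% (p * q))%N.
Proof.
move=> p0; rewrite /mul_rule mulKn// modn_dvdm ?dvdn_mull//.
have -> : ((t %/ (p * q)) %% q = (t %/ q) %% (p * q) %/ p)%N.
  by rewrite (mulnC p) divnMA modn_divl.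
have -> : (t %% (p * q) %/ q = (t %/ q) %% (p * q) %% p)%N.
  by rewrite -modn_divl modn_dvdm ?dvdn_mulr.
by rewrite -divn_eq.
Qed.

(** With [s = r N^i] and [q = N / p], one has [p s = s N / q]. The cells [i] and [i + 1] hold the
    last two digits of [floor (s N)], from which the rule computes the last digit of its quotient by
    [q]. *)
Lemma multiplies_mul_ca p : (p %| N)%N -> multiplies N (mul_ca p N) p%:R.
Proof.
move=> pN; have p0 : (0 < p)%N by exact: dvdn_gt0 pN.
have NE : N = (p * (N %/ p))%N by rewrite mulnC divnK.
have q0 : (0 < N %/ p)%N by rewrite divn_gt0// dvdn_leq.
split=> //; exists 1%N => x r i xN [r0 xr].
rewrite /mul_ca !xr; [|lia..]; rewrite /digit expfzDr// expr1z mulrA.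
set s := r * N%:R ^ i; have s0 : 0 <= s by rewrite mulr_ge0 ?exprz_ge0.
have sN0 : 0 <= s * N%:R by exact: mulr_ge0 s0 (ler0n _ _).
have sN : Num.truncn s = (Num.truncn (s * N%:R) %/ N)%N.
  by rewrite divn_truncn// mulfK.
have := mul_rule_divn (N %/ p) (Num.truncn (s * N%:R)) p0.
rewrite -NE -sN => ->; rewrite divn_truncn// -[in RHS]mulrA -/s.
congr (Num.truncn _ %% N)%N; rewrite [in N%:R]NE natrM mulrA.
rewrite mulfK ?[p%:R * s]mulrC//.
by rewrite pnatr_eq0 -lt0n.
Qed.

Lemma mul_caK p x : (p %| N)%N -> Sigma N x ->
  mul_ca (N %/ p) N (mul_ca p N x) = fun i => x (i + 1).
Proof.
move=> pN xN; have qN : (N %/ p %| N)%N by rewrite dvdn_div.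
apply: (@multiplies_inj (mul_ca (N %/ p) N \o mul_ca p N)
  (fun x i => x (i + 1)) N%:R x) => //; last exact: (multiplies_shift 1).
rewrite -[in X in multiplies _ _ X](divnK pN) natrM.
exact: multiplies_comp (multiplies_mul_ca qN) (multiplies_mul_ca pN).
Qed.

Lemma mul_ca_inj p : (p %| N)%N -> {in Sigma N &, injective (mul_ca p N)}.
Proof.
move=> pN x y; rewrite !inE => xN yN xy; apply/funext => i.
have := mul_caK pN xN; rewrite xy mul_caK// => /(congr1 (@^~ (i - 1))).
by rewrite /= subrK.
Qed.

(* [N / q] times [1 / N]: the inverse of a multiplication automaton is again
   a cellular automaton, namely a multiplication composed with a shift. *)
Lemma multiplies_mul_ca_inv q : (q %| N)%N ->
  multiplies N (mul_ca_inv q N) q%:R^-1.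
Proof.
move=> qN; have pN : (N %/ q %| N)%N by rewrite dvdn_div.
have q0 : (0 < q)%N by exact: dvdn_gt0 qN.
have := multiplies_comp (multiplies_mul_ca pN) (multiplies_shift (-1)).
have -> : (N %/ q)%:R * N%:R ^ (-1) = q%:R^-1 :> rat.
  rewrite -[in X in _ * X](divnK qN) natrM -invr_expz expr1z invfM mulrA.
  rewrite mulfV ?mul1r//.
  by rewrite pnatr_eq0 -lt0n divn_gt0// dvdn_leq.
move=> qm; apply: multiplies_ext (qm) => y yN.
have zN := multiplies_Sigma qm yN.
set z := (mul_ca _ N \o _) y in zN *.
have zy : mul_ca q N z = y.
  have qqm := multiplies_comp (multiplies_mul_ca qN) qm.
  rewrite mulfV ?pnatr_eq0 -?lt0n// in qqm.
  exact: multiplies_inj qqm multiplies_id yN.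
(* [z] shows that the choice in [mul_ca_inv] succeeds; injectivity identifies the chosen preimage
   with [z]. *)
have [wN wy] := @xgetPex _ y [set x | Sigma N x /\ mul_ca q N x = y]
  (ex_intro _ z (conj zN zy)).
by apply: (mul_ca_inj qN); rewrite ?inE// zy.
Qed.

(** The hypothesis makes the chosen decomposition a genuine one; the multiplier retains only its
    quotient of products. *)
Lemma multiplies_mul_ca_rat b : fraction_of N b !=set0 ->
  multiplies N (mul_ca_rat N b) b.
Proof.
move=> /(xgetPex ([::], [::])); rewrite /mul_ca_rat.
case: (xget _ _) => ps qs [/= psN qsN ->].
have qm : multiplies N (foldr (mul_ca_inv^~ N) ^~ qs) (\prod_(q <- qs) q%:R)^-1.
  elim: qs qsN => [_|q qs IHqs qsN]; first by
    rewrite big_nil invr1; exact: multiplies_id.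
  have /andP[_ qN] := qsN q (mem_head _ _).
  rewrite big_cons invfM; apply: (multiplies_comp (multiplies_mul_ca_inv qN)).
  by apply: IHqs => q' q's; apply: qsN; rewrite inE q's orbT.
rewrite /mul_ca_comp; elim: ps psN => [_|p ps IHps psN].
  by rewrite big_nil mul1r.
have /andP[_ pN] := psN p (mem_head _ _).
rewrite big_cons -mulrA; apply: (multiplies_comp (multiplies_mul_ca pN)).
by apply: IHps => p' p's; apply: psN; rewrite inE p's orbT.
Qed.

End multiplication_automata.

(** * Cubes and tilings *)

Section prebasis.
Variables (d : nat) (n : 'I_d -> nat).
Hypothesis n_gt0 : forall i, (0 < n i)%N.
Implicit Types (u v z : 'cV[int]_d) (i : 'I_d) (V : {set 'I_d}).

Let nneq0 i : (n i)%:R != 0 :> rat.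
Proof. by rewrite pnatr_eq0 -lt0n. Qed.

Lemma pre_prod_gt0 : (0 < pre_prod n)%N.
Proof. exact: prodn_gt0. Qed.

Lemma mval_alpha v : mval n v = alpha (- v) n.
Proof. by apply: eq_bigr => i _; rewrite mxE. Qed.

Lemma alpha_gt0 v : 0 < alpha v n.
Proof. by apply: prodr_gt0 => i _; rewrite exprz_gt0// ltr0n. Qed.

Lemma alphaD u v : alpha (u + v) n = alpha u n * alpha v n.
Proof.
by rewrite /alpha -big_split; apply: eq_bigr => i _; rewrite mxE expfzDr.
Qed.

Lemma alphaN v : alpha (- v) n = (alpha v n)^-1.
Proof.
by rewrite /alpha -prodfV; apply: eq_bigr => i _; rewrite mxE invr_expz.
Qed.

Lemma alphaB u v : alpha (u - v) n = alpha u n / alpha v n.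
Proof. by rewrite alphaD alphaN. Qed.

Lemma alpha_delta i : alpha (e_ i) n = (n i)%:R.
Proof.
rewrite /alpha (bigD1 i)//= big1 ?mulr1 => [|j ji].
  by rewrite mxE !eqxx expr1z.
by rewrite mxE (negPf ji) expr0z.
Qed.

Lemma alpha_const (k : int) : alpha (const_mx k) n = (pre_prod n)%:R ^ k.
Proof.
rewrite /alpha /pre_prod natr_prod.
transitivity (\prod_i (n i)%:R ^ k : rat).
  by apply: eq_bigr => i _; rewrite mxE.
case: k => k; first exact: prodrXl.
by rewrite -[RHS]/((_ ^+ k.+1)^-1) -prodrXl -prodfV.
Qed.

Lemma alpha_nat v : vle 0 v -> exists2 k, (0 < k)%N & alpha v n = k%:R.
Proof.
move=> /forallP v0; have Nv0 : vle (- v) 0.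
  by apply/forallP => i; have := v0 i; rewrite !mxE oppr_le0.
exists (Num.truncn (mval n (- v))).
  by rewrite -(ltr0n rat) -mval_nat ?mval_alpha ?alpha_gt0.
by rewrite -mval_nat ?mval_alpha ?opprK.
Qed.

Lemma fraction_of_alpha (N : nat) v : (forall i, n i %| N)%N ->
  fraction_of N (alpha v n) !=set0.
Proof.
move=> nN; rewrite /alpha.
elim: (index_enum _) => [|i s [[ps qs] [psN qsN sE]]].
  by exists ([::], [::]); split=> //; rewrite !big_nil divr1.
have niN : ((0 < n i) && (n i %| N))%N by rewrite n_gt0 nN.
rewrite big_cons sE; case: (v i 0) => k.
  exists (nseq k (n i) ++ ps, qs); split=> //=.
    by move=> p; rewrite mem_cat mem_nseq => /orP[/andP[_ /eqP->//]|/psN].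
  by rewrite big_cat/= big_nseq GRing.iter_mulr_1 mulrA.
exists (ps, nseq k.+1 (n i) ++ qs); split=> //.
  by move=> p; rewrite mem_cat mem_nseq => /orP[/andP[_ /eqP->//]|/qsN].
rewrite big_cat big_nseq GRing.iter_mulr_1 invfM NegzE -exprnN.
by rewrite mulrCA.
Qed.

Lemma mval_vertex V : Num.truncn (mval n (vertex V)) = (\prod_(i in V) n i)%N.
Proof.
suff -> : mval n (vertex V) = (\prod_(i in V) n i)%:R by rewrite natrK.
rewrite mval_alpha opprK natr_prod.
apply: (big_ind2 (fun u (k : rat) => alpha u n = k)).
- by rewrite /alpha big1// => i _; rewrite mxE.
- by move=> u k v l <- <-; rewrite alphaD.
- by move=> i _; rewrite alpha_delta.
Qed.

Lemma entry_cube a F : entry (cube n a) F =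
  ((a %/ \prod_(i in (val F).1) n i) %%
    ((\prod_(i in (val F).2) n i) %/ (\prod_(i in (val F).1) n i)))%N.
Proof. by rewrite /entry ffunE /base_digit !mval_vertex. Qed.

Lemma dvdn_prod_subset (V W : {set 'I_d}) : V \subset W ->
  (\prod_(i in V) n i %| \prod_(i in W) n i)%N.
Proof.
move=> VW; rewrite [X in (_ %| X)%N](finset.big_setID V)/=.
by rewrite (finset.setIidPr VW) dvdn_mulr.
Qed.

Lemma prod_setT : (\prod_(i in [set: 'I_d]%SET) n i)%N = pre_prod n.
Proof. by apply: eq_bigl => i; rewrite inE. Qed.

Lemma dvdn_pre_prod V : (\prod_(i in V) n i %| pre_prod n)%N.
Proof. by rewrite -prod_setT; exact/dvdn_prod_subset/finset.subsetT. Qed.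

(** The products delimiting each digit divide [pre_prod n], so no entry sees beyond it. Cubes can
    hence be written with unreduced floors. *)
Lemma cube_modn a : cube n (a %% pre_prod n) = cube n a.
Proof.
apply/ffunP => F; have := entry_cube a F; rewrite /entry => ->.
rewrite -[LHS]/(entry _ F) entry_cube divn_modl ?dvdn_pre_prod//.
rewrite modn_dvdm//; case: F => -[V W] /= VW.
have [c WE] := dvdnP (dvdn_prod_subset VW).
have [e ->] := dvdnP (dvdn_pre_prod W).
by rewrite -muln_divA ?dvdn_mull// dvdn_prod_subset.
Qed.

Lemma entry_face0 a V :
  entry (cube n a) (face0 V) = (a %% \prod_(i in V) n i)%N.
Proof. by rewrite entry_cube/= big_set0 divn1 divn1. Qed.

Lemma cube_val_cube a : cube_val (cube n a) = (a %% pre_prod n)%N.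
Proof. by rewrite /cube_val entry_face0 prod_setT. Qed.

Lemma cube_valK t : cubes n t -> cube n (cube_val t) = t.
Proof. by move=> [a _ <-]; rewrite cube_val_cube cube_modn. Qed.

Lemma prod_setC1 i : (\prod_(j in ~: [set i]%SET) n j = pre_prod n %/ n i)%N.
Proof.
rewrite /pre_prod [in RHS](bigD1 i)//= mulKn//; apply: eq_bigl => j.
by rewrite !inE.
Qed.

Lemma dvdn_pre i : (n i %| pre_prod n)%N.
Proof. by rewrite /pre_prod (bigD1 i)//= dvdn_mulr. Qed.

Lemma entry_face0_setC1 a i :
  entry (cube n a) (face0 (~: [set i])%SET) = (a %% (pre_prod n %/ n i))%N.
Proof. by rewrite entry_face0 prod_setC1. Qed.

Lemma entry_face1_set1 a i : entry (cube n a) (face1 [set i]%SET) =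
  (a %/ n i %% (pre_prod n %/ n i))%N.
Proof. by rewrite entry_cube/= prod_setT big_set1. Qed.

(** Matching compares the low part of one tile with the high part of the next, which is a congruence
    between representatives that need not be reduced. *)
Lemma XspaceP (f : tiling d) : Xspace n f <->
  exists2 a : 'cV[int]_d -> nat, f = (fun z => cube n (a z)) &
    forall z i, (a z = a (z + e_ i)%R %/ n i %[mod pre_prod n %/ n i])%N.
Proof.
split=> [[fc fE]|[a -> aE]].
  exists (fun z => cube_val (f z)); first by
    apply/funext => z /=; rewrite cube_valK.
  by move=> z i; have := fE z i;
    rewrite -[f z]cube_valK// -[f (z + _)]cube_valK//
    entry_face0_setC1 entry_face1_set1 !cube_valK.
split=> [z|z i]; last by rewrite entry_face0_setC1 entry_face1_set1 aE.
exists (a z %% pre_prod n)%N; last exact: cube_modn.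
by rewrite /= ltn_pmod// pre_prod_gt0.
Qed.

(** Iterates the congruence of [XspaceP] along [s]: each step strips one factor from the far tile,
    and divisibility keeps the moduli compatible. *)
Lemma Xspace_pre_prod (f : tiling d) (s : seq 'I_d) (z : 'cV[int]_d) :
  Xspace n f -> (\prod_(i <- s) n i %| pre_prod n)%N ->
  (cube_val (f (z + \sum_(i <- s) e_ i)%R) %/ \prod_(i <- s) n i =
   cube_val (f z) %% (pre_prod n %/ \prod_(i <- s) n i))%N.
Proof.
move=> /XspaceP[a -> aE]; elim: s z => [|i s IHs] z.
  rewrite !big_nil !divn1 addr0 cube_val_cube => _.
  by rewrite modn_mod.
rewrite !big_cons => isN; have [c NE] := dvdnP isN.
have s0 : (0 < \prod_(i <- s) n i)%N.
  by move: pre_prod_gt0; rewrite NE !muln_gt0 => /and3P[].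
have sN : (\prod_(i <- s) n i %| pre_prod n)%N.
  exact: dvdn_trans (dvdn_mull _ _) isN.
have NsE : (pre_prod n %/ \prod_(i <- s) n i = c * n i)%N.
  by rewrite NE mulnA mulnK.
have NiE : (pre_prod n %/ n i = c * \prod_(i <- s) n i)%N.
  by rewrite NE mulnCA mulKn.
have NisE : (pre_prod n %/ (\prod_(i <- s) n i * n i) = c)%N.
  by rewrite NE mulnC (mulnC (n i)) mulKn// muln_gt0 s0 n_gt0.
rewrite addrA (mulnC (n i)) divnMA IHs// NsE NisE -modn_divl !cube_val_cube.
rewrite divn_modl ?dvdn_pre//.
have cN k : (k %% pre_prod n = k %[mod c])%N.
  by rewrite modn_dvdm// NE dvdn_mulr.
rewrite cN -[in RHS](@modn_dvdm (pre_prod n %/ n i)) ?NiE ?dvdn_mulr//.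
by rewrite -NiE aE modn_dvdm ?NiE ?dvdn_mulr// modn_dvdm ?NiE ?dvdn_mulr.
Qed.

(** Let [q = N / n i] and let [w] be on the diagonal through [z]. The tile at [w + e_ i] has
    quotient by [n i] equal to the tile at [w] modulo [q], and remainder equal to the tile at
    [w + const_mx 1] divided by [q], reached through the other directions. This is the local
    rule. *)
Lemma diag_shift_delta (f : tiling d) (z : 'cV[int]_d) i : Xspace n f ->
  diag n (tile_shift (z + e_ i) f) =
  mul_ca (n i) (pre_prod n) (diag n (tile_shift z f)).
Proof.
move=> fX; apply/funext => k; rewrite /mul_ca /mul_rule /diag /tile_shift.
set w := const_mx k + z; rewrite addrA.
have -> : const_mx (k + 1) + z =
    w + e_ i + \sum_(j <- [seq j <- enum 'I_d | j != i]) e_ j.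
  have -> : const_mx (k + 1) + z = w + \sum_j e_ j.
    apply/colP => j; rewrite !mxE summxE (bigD1 j)//=.
    rewrite big1 ?mxE ?eqxx => [|l lj].
      by rewrite addr0 addrAC.
    by rewrite mxE andbT eq_sym (negPf lj).
  rewrite big_filter big_enum_cond/= -[RHS]addrA; congr (w + _).
  by rewrite (bigD1 i).
have sE : (\prod_(j <- [seq j <- enum 'I_d | j != i]) n j =
    pre_prod n %/ n i)%N.
  rewrite big_filter big_enum_cond/= -prod_setC1.
  by apply: eq_bigl => j; rewrite !inE.
rewrite -sE Xspace_pre_prod ?sE ?dvdn_div ?dvdn_pre// divnA ?dvdn_pre//.
rewrite mulKn ?pre_prod_gt0//.
have := @Xspace_pre_prod f [:: i] w fX; rewrite !big_seq1 dvdn_pre => <- //.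
by rewrite -divn_eq.
Qed.

Lemma diag_Sigma (f : tiling d) : Xspace n f -> Sigma (pre_prod n) (diag n f).
Proof.
move=> /XspaceP[a -> _] i.
by rewrite /diag cube_val_cube ltn_pmod// pre_prod_gt0.
Qed.

Lemma Xspace_shift (f : tiling d) (z : 'cV[int]_d) :
  Xspace n f -> Xspace n (tile_shift z f).
Proof.
move=> [fc fE]; split=> [y|y i]; first exact: fc.
by rewrite /tile_shift fE addrAC.
Qed.

End prebasis.

(** * Paths of unit steps *)

Lemma path_end_cat (d : nat) (w1 w2 : seq (bool * 'I_d)) (p : 'cV[int]_d) :
  path_end p (w1 ++ w2) = path_end (path_end p w1) w2.
Proof. by elim: w1 p => //= s w1 IHw p. Qed.

(** Walks along the axes one after another. *)
Lemma path_ex (d : nat) (p p' : 'cV[int]_d) : exists w, path_end p w = p'.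
Proof.
suff [w wE] : exists w, path_end p w = p + \sum_i (p' - p) i 0 *: e_ i.
  exists w; rewrite wE; apply/colP => i.
  rewrite !mxE summxE (bigD1 i)//= big1 => [|j ji].
    by rewrite !mxE !eqxx mulr1 addr0 addrC subrK.
  by rewrite !mxE eq_sym (negPf ji) mulr0.
move: (p' - p) => c.
elim: (index_enum _) p => [|i s IHs] q.
  by exists [::]; rewrite big_nil addr0.
have [w wE] := IHs (q + c i 0 *: e_ i).
exists (nseq `|c i 0%R|%N (c i 0 < 0, i) ++ w).
rewrite path_end_cat big_cons addrA -wE.
congr path_end; have -> : c i 0 *: e_ i = step (c i 0 < 0, i) *+ `|c i 0%R|%N.
  by rewrite /step/= scalerMnl -mulr_natr natz abszE mulr_sign_norm.
elim: `|c i 0%R|%N q {wE} => [|m IHm] q /=; first by rewrite addr0.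
by rewrite IHm mulrS addrA.
Qed.

(** * Rationals sharing a large window with a configuration *)

Section eventually_agree.
Variables (N : nat) (x : config).

(** Works like a filter: finitely many requirements, each with its own window, are met by one common
    [r]. *)
Definition eventually_agree (P : rat -> Prop) : Prop :=
  exists k, forall r, agrees_near N x r 0 k -> P r.

Lemma eventually_agree_ex P : (0 < N)%N -> Sigma N x ->
  eventually_agree P -> exists2 r, 0 <= r & P r.
Proof.
move=> N_gt0 xN [k kP]; have [r xr] := agrees_near_ex N_gt0 0 k xN.
by exists r; [case: xr|exact: kP].
Qed.

Lemma eventually_agree_and P Q :
  eventually_agree P -> eventually_agree Q ->
  eventually_agree (fun r => P r /\ Q r).
Proof.
move=> [k kP] [l lQ]; exists (k + l)%N => r xr.
by split; [apply: kP|apply: lQ]; apply: agrees_near_le xr; lia.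
Qed.

Lemma eventually_agree_all (T : eqType) (s : seq T) (P : T -> rat -> Prop) :
  (forall t, eventually_agree (P t)) ->
  eventually_agree (fun r => forall t, t \in s -> P t r).
Proof.
move=> sP; elim: s => [|t s IHs]; first by exists 0%N.
have [k kP] := eventually_agree_and (sP t) IHs.
exists k => r /kP[Pt Ps] u; rewrite inE => /predU1P[->//|]; exact: Ps.
Qed.

Lemma multiplies_eventually F b i : Sigma N x -> multiplies N F b ->
  eventually_agree (fun r => F x i = digit N (b * r) i).
Proof.
move=> xN [_ [k FP]]; exists (`|i| + k)%N => r xr; apply: FP => //.
by apply: agrees_near_le xr; rewrite subr0.
Qed.

End eventually_agree.

(** * Tessellations, labels and path sums *)

Section tess.
Variables (d : nat) (n : 'I_d -> nat).
Hypothesis n_gt0 : forall i, (0 < n i)%N.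
Implicit Types (x : config) (z p : 'cV[int]_d) (i : 'I_d) (f : tiling d).
Let N := pre_prod n.
Let N_gt0 : (0 < N)%N := pre_prod_gt0 n_gt0.

Lemma multiplies_alpha z : multiplies N (mul_ca_rat N (alpha z n)) (alpha z n).
Proof.
by apply: multiplies_mul_ca_rat => //; apply: fraction_of_alpha => // i;
  exact: dvdn_pre.
Qed.

Lemma cube_digit r : cube n (digit N r 0) = cube n (Num.truncn r).
Proof. by rewrite /digit expr0z mulr1 cube_modn. Qed.

Lemma tess_eventually x z : Sigma N x ->
  eventually_agree N x (fun r =>
    tess n x z = cube n (Num.truncn (alpha z n * r))).
Proof.
move=> xN; have [k kP] := multiplies_eventually 0 xN (multiplies_alpha z).
by exists k => r /kP; rewrite /tess => ->; rewrite cube_digit.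
Qed.

Lemma truncn_alpha_divn p z r k : 0 <= r -> alpha z n = k%:R ->
  (Num.truncn (alpha (p + z) n * r) %/ k)%N = Num.truncn (alpha p n * r).
Proof.
move=> r0 zk; have k0 : k%:R != 0 :> rat by rewrite -zk gt_eqF ?alpha_gt0.
rewrite divn_truncn; last exact: mulr_ge0 (ltW (alpha_gt0 n_gt0 _)) r0.
by rewrite alphaD// zk mulrAC mulfK.
Qed.

Lemma tess_Xspace x : Sigma N x -> Xspace n (tess n x).
Proof.
move=> xN; apply/XspaceP => //; eexists; first by [].
move=> z i /=.
have [r r0 [-> ->]] := eventually_agree_ex N_gt0 xN (eventually_agree_and
  (multiplies_eventually 0 xN (multiplies_alpha z))
  (multiplies_eventually 0 xN (multiplies_alpha (z + e_ i)))).
rewrite /digit expr0z !mulr1 modn_dvdm ?dvdn_div ?dvdn_pre//.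
rewrite divn_modl ?dvdn_pre// (truncn_alpha_divn _ r0 (alpha_delta _ _))//.
by rewrite modn_mod.
Qed.

(** On the diagonal [alpha] is a power of [N], so the automaton is a shift. *)
Lemma tessK x : Sigma N x -> diag n (tess n x) = x.
Proof.
move=> xN; apply/funext => i; rewrite /diag cube_val_cube//.
have := multiplies_alpha (const_mx i); rewrite alpha_const => iN.
rewrite (multiplies_inj N_gt0 iN (multiplies_shift N_gt0 i))//.
by rewrite add0r modn_small.
Qed.

(** Equality of diagonals spreads along a path from 0: a forward step applies a multiplication
    automaton, a backward step uses its injectivity. *)
Lemma Xspace_diag_inj f g : Xspace n f -> Xspace n g ->
  diag n f = diag n g -> f = g.
Proof.
move=> fX gX fg; suff fgz z : diag n (tile_shift z f) = diag n (tile_shift z g).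
  apply/funext => z.
  rewrite -(cube_valK n_gt0 (fX.1 z)) -(cube_valK n_gt0 (gX.1 z)).
  congr cube; have := congr1 (@^~ 0) (fgz z).
  by rewrite /diag /tile_shift (_ : const_mx 0 = 0) ?add0r.
have [w <-] := path_ex 0 z.
have : diag n (tile_shift 0 f) = diag n (tile_shift 0 g).
  apply/funext => i; have := congr1 (@^~ i) fg.
  by rewrite /diag /tile_shift addr0.
elim: w 0 => //= -[b i] w IHw p fgp; apply: IHw; case: b; rewrite /step/=.
  apply: (mul_ca_inj N_gt0 (dvdn_pre n i)); rewrite ?inE;
    [exact/diag_Sigma/Xspace_shift..|].
  by rewrite -!diag_shift_delta// scaleN1r subrK.
by rewrite scale1r !diag_shift_delta// fgp.
Qed.

Lemma diagK f : Xspace n f -> tess n (diag n f) = f.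
Proof.
move=> fX; have fN := diag_Sigma n_gt0 fX.
by apply: Xspace_diag_inj; rewrite ?tessK//; exact: tess_Xspace.
Qed.

(* [z |-> floor (alpha z * r) / alpha z] is a potential of the labels: they
   are its increments, up to the factors [mval n]. *)
Lemma label_truncn f z i r : 0 <= r ->
  f z = cube n (Num.truncn (alpha z n * r)) ->
  mval n z * (label f z i)%:R =
    (Num.truncn (alpha z n * r))%:R / alpha z n -
    (Num.truncn (alpha (z - e_ i) n * r))%:R / alpha (z - e_ i) n.
Proof.
move=> r0 fz; rewrite /label fz entry_face0// big_set1 mval_alpha alphaN//.
have := truncn_alpha_divn (z - e_ i) r0 (alpha_delta n i); rewrite subrK => <-.
rewrite alphaB// alpha_delta invf_div.
set T := Num.truncn _; rewrite [in T%:R / _](divn_eq T (n i)) natrD natrM.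
rewrite mulrA mulrDl [X in _ = X + _ - _]mulrAC addrAC mulrAC subrr add0r.
by rewrite mulrC.
Qed.

(** [s] collects the upper ends of the edges walked, whose tiles hold the labels; the increments of
    the potential telescope. *)
Lemma path_sum_truncn f p w : exists s : seq 'cV[int]_d, forall r, 0 <= r ->
  (forall z, z \in s -> f z = cube n (Num.truncn (alpha z n * r))) ->
  path_sum n f p w =
    (Num.truncn (alpha (path_end p w) n * r))%:R / alpha (path_end p w) n -
    (Num.truncn (alpha p n * r))%:R / alpha p n.
Proof.
elim: w p => [|[b i] w IHw] p /=; first by exists [::] => r _ _; rewrite subrr.
have [s sP] := IHw (p + step (b, i)).
exists ((if b then p else p + e_ i) :: s) => r r0 fs.
rewrite (sP r)// => [|z zs]; last by apply: fs; rewrite inE zs orbT.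
rewrite /step_sum/= -mulrA (label_truncn i r0) ?fs ?mem_head//.
case: b {fs sP} => /=; rewrite /step/=.
  by rewrite scaleN1r mulN1r opprB addrC addrA subrK.
by rewrite scale1r mul1r addrK addrC addrA subrK.
Qed.

(** Telescoping gives the same value for every path, hence for the chosen one. With
    [T = floor (alpha p' r)] it is [T - k floor (T / k)]. *)
Lemma lambda_truncn f p p' k : alpha (p' - p) n = k%:R ->
  exists s : seq 'cV[int]_d, forall r, 0 <= r ->
  (forall z, z \in s -> f z = cube n (Num.truncn (alpha z n * r))) ->
  lambda n f p p' = (Num.truncn (alpha p' n * r) %% k)%:R.
Proof.
move=> pk; rewrite /lambda /pair_sum.
have [|w pw <-] := @xgetPex _ 0
    [set path_sum n f p w | w in [set w | path_end p w = p']].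
  by have [w pw] := path_ex p p'; exists (path_sum n f p w), w.
have [s sP] := path_sum_truncn f p w; exists s => r r0 /(sP r r0) ->.
rewrite {}pw mval_alpha alphaN// invrK -(truncn_alpha_divn p r0 pk).
rewrite [p + _]addrC subrK; set T := Num.truncn _.
rewrite -[in alpha p n](subrK p' p) -opprB alphaD// alphaN// pk.
have an0 z : alpha z n != 0 by rewrite gt_eqF ?alpha_gt0.
rewrite invfM invrK mulrBl mulfVK// mulrA mulfVK//.
by rewrite [in T%:R](divn_eq T k) natrD natrM addrAC subrr add0r.
Qed.

End tess.

(** * Macrotiles and conjugacy *)

Section macrotiles.
Variables (d d' : nat) (n : 'I_d -> nat) (A : 'M[nat]_(d, d')).
Hypothesis n_gt0 : forall i, (0 < n i)%N.
Hypothesis A_row : forall i, exists j, (0 < A i j)%N.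
Let nA := pre_mx n A.
Let N := pre_prod n.
Let N' := pre_prod nA.

Lemma pre_mx_gt0 j : (0 < nA j)%N.
Proof. by apply: prodn_gt0 => i; rewrite expn_gt0 n_gt0. Qed.

Let N_gt0 : (0 < N)%N := pre_prod_gt0 n_gt0.
Let N'_gt0 : (0 < N')%N := pre_prod_gt0 pre_mx_gt0.

(** Both sides are the double product of the [n i ^ (A i j * v j)]. *)
Lemma alpha_appA v : alpha (appA A v) n = alpha v nA.
Proof.
have nneq0 i : (n i)%:R != 0 :> rat by rewrite pnatr_eq0 -lt0n.
transitivity (\prod_i \prod_j (n i)%:R ^ ((A i j)%:Z * v j 0) : rat).
  apply: eq_bigr => i _; rewrite mxE.
  transitivity ((n i)%:R ^ (\sum_j (A i j)%:Z * v j 0) : rat).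
    by congr (_ ^ _); apply: eq_bigr => j _; rewrite mxE.
  apply: (big_morph (fun k : int => (n i)%:R ^ k)) => // k l.
  by rewrite expfzDr.
rewrite exchange_big; apply: eq_bigr => j _ /=; rewrite natr_prod.
transitivity (\prod_i ((n i ^ A i j)%N%:R : rat) ^ v j 0).
  by apply: eq_bigr => i _; rewrite natrX -exprz_exp.
case: (v j 0) => k; first exact: prodrXl.
by rewrite -[RHS]/((_ ^+ k.+1)^-1) -prodrXl -prodfV.
Qed.

(** A positive entry of row [i] puts [n i] into some [nA j]; this lets [alpha z n] be decomposed
    over [N']. *)
Lemma dvdn_pre_mx i : (n i %| N')%N.
Proof.
have [j Aij] := A_row i; apply: dvdn_trans (dvdn_pre nA j).
rewrite /nA /pre_mx (bigD1 i)//= dvdn_mulr//.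
by rewrite -[X in (X %| _)%N]expn1 dvdn_exp2l.
Qed.

Lemma appAB u v : appA A (u - v) = appA A u - appA A v.
Proof. exact: mulmxBr. Qed.

(** Guarantees that the choice in [micro] is a valid pair and not the default. *)
Lemma appA_bounds (y : 'cV[int]_d) : exists z : 'cV[int]_d' * 'cV[int]_d',
  [/\ vle 0 (appA A z.1 - y), vle z.2 z.1 &
      vle (appA A z.2) (y - const_mx 1)].
Proof.
(* The row sums of [A] are at least 1, so [A] sends the constant vector [B] to entries at least [B];
   the extra 1 absorbs [const_mx 1]. *)
pose B : int := 1 + \sum_i `|y i 0|.
have B0 : 0 <= B by rewrite addr_ge0// sumr_ge0.
have yB i : `|y i 0| + 1 <= B.
  rewrite addrC /B (bigD1 i)//= addrA lerDl sumr_ge0//.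
have AB k i : appA A (const_mx k) i 0 = (\sum_j (A i j)%:Z) * k.
  by rewrite /appA !mxE mulr_suml; apply: eq_bigr => j _; rewrite !mxE.
have A1 i : 1 <= \sum_j (A i j)%:Z.
  have [j Aij] := A_row i; rewrite (bigD1 j)//= ler_wpDr ?sumr_ge0//.
exists (const_mx B, const_mx (- B)); split; apply/forallP => i; rewrite !mxE.
- have := AB B i; rewrite mxE => ->; rewrite subr_ge0.
  rewrite (le_trans (ler_norm _))// (le_trans _ (ler_peMl B0 (A1 i)))//.
  by rewrite (le_trans _ (yB i))// lerDl.
- by rewrite (le_trans _ B0)// oppr_le0.
- have := AB (- B) i; rewrite mxE => ->; rewrite mulrN lerNl opprB.
  rewrite (le_trans _ (ler_peMl B0 (A1 i)))// (le_trans _ (yB i))//.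
  rewrite addrC lerD2r.
  by rewrite -normrN ler_norm.
Qed.

(** The label from [z2] to [z1] is [floor (alpha (A z1) r)] modulo [kv k2 N]. Dividing by [kv]
    leaves [floor (alpha y r)] modulo [k2 N], and the extracted digit is its residue modulo [N]. *)
Lemma micro_tess x y : Sigma N' x -> eventually_agree N' x (fun r =>
  micro n A (tess nA x) y = cube n (Num.truncn (alpha y n * r))).
Proof.
move=> xN; rewrite /micro.
have /(xgetPex (0, 0)) := appA_bounds y.
case: (xget _ _) => z1 z2 [/= v_ge0 z21 z2y].
have [kv kv_gt0 vE] := alpha_nat n_gt0 v_ge0.
have [k2 k2_gt0 k2E] : exists2 k, (0 < k)%N &
    alpha (y - const_mx 1 - appA A z2) n = k%:R.
  by apply: alpha_nat => //; apply/forallP => i; have /forallP/(_ i) := z2y;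
    rewrite !mxE subr_ge0.
have kE : alpha (z1 - z2) nA = (kv * (k2 * N))%N%:R.
  rewrite -alpha_appA !natrM -vE -k2E -[N%:R]expr1z -alpha_const -!alphaD//.
  congr (alpha _ n); rewrite appAB; move: (appA A z1) (appA A z2) => u w.
  by apply/colP => i; rewrite !mxE [_ - 1 - _]addrAC subrK addrA subrK.
have [s sP] := lambda_truncn pre_mx_gt0 (tess nA x) kE.
have [l lP] := eventually_agree_all s
  (fun z => tess_eventually pre_mx_gt0 z xN).
exists l => r xr; have r0 : 0 <= r by case: xr.
rewrite (sP r r0 (lP r xr)) natrK.
have := truncn_alpha_divn n_gt0 y r0 vE.
rewrite [y + _]addrC subrK alpha_appA; move: (Num.truncn _) => T Tkv.
move: (appA A z1 - y) vE => v vE.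
rewrite /base_digit !mval_alpha opprB opprK [const_mx 1 + _]addrC alphaD//.
rewrite alpha_const expr1z vE -natrM !natrK mulKn//.
rewrite divn_modl ?dvdn_mulr// mulKn// modn_dvdm ?dvdn_mull// Tkv.
exact: cube_modn.
Qed.

Lemma macro_truncn (f : tiling d) v : exists s : seq 'cV[int]_d,
  forall r, 0 <= r ->
  (forall z, z \in s -> f z = cube n (Num.truncn (alpha z n * r))) ->
  macro n A f v = cube nA (Num.truncn (alpha v nA * r)).
Proof.
have N'E : alpha (appA A v - appA A (v - const_mx 1)) n = N'%:R.
  by rewrite -appAB opprB addrC subrK alpha_appA alpha_const expr1z.
have [s sP] := lambda_truncn n_gt0 f N'E; exists s => r r0 /(sP r r0) fE.
by rewrite /macro fE natrK alpha_appA; exact/cube_modn/pre_mx_gt0.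
Qed.

Lemma multiplies_alpha_mx z :
  multiplies N' (mul_ca_rat N' (alpha z n)) (alpha z n).
Proof.
by apply: multiplies_mul_ca_rat => //; apply: fraction_of_alpha => // i;
  exact: dvdn_pre_mx.
Qed.

Lemma macro_shift_tess x z : Sigma N' x ->
  tess nA (mul_ca_rat N' (alpha z n) x) = macro_shift n A z (tess nA x).
Proof.
move=> xN; apply/funext => v; rewrite /macro_shift.
have [s sP] := macro_truncn (tile_shift z (micro n A (tess nA x))) v.
have [r r0 [rs rv]] := eventually_agree_ex N'_gt0 xN (eventually_agree_and
  (eventually_agree_all s (fun y => micro_tess (y + z) xN))
  (multiplies_eventually 0 xN (multiplies_comp N'_gt0
    (multiplies_alpha pre_mx_gt0 v) (multiplies_alpha_mx z)))).
rewrite (sP (alpha z n * r)).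
- rewrite /tess [mul_ca_rat _ _ _ _]rv cube_digit ?mulrA//.
  exact: pre_mx_gt0.
- exact: mulr_ge0 (ltW (alpha_gt0 n_gt0 _)) r0.
- by move=> y /rs; rewrite alphaD// mulrA.
Qed.

End macrotiles.

Lemma tess_shift (d : nat) (n : 'I_d -> nat) (x : config) (z : 'cV[int]_d) :
  (forall i, (0 < n i)%N) -> Sigma (pre_prod n) x ->
  tess n (mul_ca_rat (pre_prod n) (alpha z n) x) = tile_shift z (tess n x).
Proof.
move=> n0 xN; apply/funext => y; have N0 := pre_prod_gt0 n0.
rewrite /tess /tile_shift alphaD//; congr (cube n (_ 0)).
have := multiplies_comp N0 (multiplies_alpha n0 y) (multiplies_alpha n0 z).
have := multiplies_alpha n0 (y + z); rewrite alphaD// => yz /multiplies_inj.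
exact.
Qed.

Lemma multiplies_local (N : nat) (F : config -> config) (b : rat) (i : int) :
  (0 < N)%N -> multiplies N F b -> exists s : seq int, forall x y,
    Sigma N x -> Sigma N y -> {in s, x =1 y} -> F x i = F y i.
Proof.
move=> N0 [_ [k FP]].
exists [seq i + k%:Z - j%:Z | j <- iota 0 (k + k).+1] => x y xN yN xy.
have [r xr] := agrees_near_ex N0 i k xN.
rewrite (FP x r)// (FP y r)//; split=> [|j ji]; first by case: xr.
rewrite -xy; first by apply xr.2.
by apply/mapP; exists `|(i + k%:Z - j)%R|%N; rewrite ?mem_iota; lia.
Qed.

Lemma compact_Sigma (N : nat) : compact (Sigma N).
Proof.
apply: (@tychonoff int (fun=> nat) (fun=> [set k | (k < N)%N])) => _.
exact/finite_compact/finite_II.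
Qed.

Section conjugacy.
Variables (R : realType) (d : nat) (n : 'I_d -> nat).
Hypothesis n_gt0 : forall i, (0 < n i)%N.
Let N := pre_prod n.
Let N_gt0 : (0 < N)%N := pre_prod_gt0 n_gt0.

Lemma inverse_maps_tess_diag :
  inverse_maps (Sigma N) (Xspace n) (@tess d n) (@diag d n).
Proof.
split=> [x|f|x|f].
- exact: tess_Xspace.
- exact: diag_Sigma.
- exact: tessK.
- exact: diagK.
Qed.

Lemma set_bij_tess : set_bij (Sigma N) (Xspace n) (tess n).
Proof.
have [tX dS tK dK] := inverse_maps_tess_diag; split=> //.
- by move=> x y; rewrite !inE => xN yN xy; rewrite -(tK x)// xy tK.
- by move=> f fX; exists (diag n f); [exact: dS|exact: dK].
Qed.

Lemma continuous_tess : {within Sigma N, continuous (tess n)}.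
Proof.
apply: within_continuous_ptws => x xN z.
have [s sP] := multiplies_local 0 N_gt0 (multiplies_alpha n_gt0 z).
by exists s => y yN yx; rewrite /tess (sP y x).
Qed.

Lemma compact_Xspace : compact (Xspace n).
Proof.
have [tX _ tsurj] := set_bij_tess.
rewrite (_ : Xspace n = tess n @` Sigma N); last first.
  by apply/seteqP; split=> // _ [x xN <-]; exact: tX.
exact: continuous_compact continuous_tess (@compact_Sigma N).
Qed.

Lemma conjugate_via_tess (F : config -> config) (G : tiling d -> tiling d) b :
  multiplies N F b ->
  (forall x, Sigma N x -> tess n (F x) = G (tess n x)) ->
  conjugate_via R (Sigma N) F (Xspace n) G (tess n).
Proof.
move=> Fb FG; have [tX dS tK dK] := inverse_maps_tess_diag.
have FS := multiplies_Sigma N_gt0 Fb.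
have GE f : Xspace n f -> G f = tess n (F (diag n f)).
  by move=> fX; rewrite FG ?dK//; exact: dS.
split=> //; [split=> //|split=> //| |].
- exact: compact_Sigma.
- exact: metrizable_ptws.
- apply: within_continuous_ptws => x xN i.
  have [s sP] := multiplies_local i N_gt0 Fb.
  by exists s => y yN yx; exact: sP.
- exact: compact_Xspace.
- exact: metrizable_ptws.
- by move=> f fX; rewrite /= GE//; exact/tX/FS/dS.
- apply: within_continuous_ptws => f fX z.
  have [s sP] := multiplies_local 0 N_gt0
    (multiplies_comp N_gt0 (multiplies_alpha n_gt0 z) Fb).
  exists [seq const_mx i | i <- s] => g gX gf; rewrite !GE//.
  congr cube; apply: sP; [exact: dS..|] => i is_.
  by rewrite /diag gf//; exact: map_f.
- exact: set_bij_tess.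
- exact: continuous_tess.
Qed.

End conjugacy.

Theorem theorem5p7 (R : realType) (d d' : nat) (n : 'I_d -> nat)
    (A : 'M[nat]_(d, d'))
    (n_gt0 : forall i, (0 < n i)%N)
    (A_row : forall i, exists j, (0 < A i j)%N) :
  let N := pre_prod n in
  let nA := pre_mx n A in
  let N' := pre_prod nA in
  [/\ inverse_maps (Sigma N) (Xspace n) (@tess d n) (@diag d n),
      forall z : 'cV[int]_d,
        conjugate_via R (Sigma N') (mul_ca_rat N' (alpha z n))
          (Xspace nA) (macro_shift n A z) (tess nA) &
      forall z : 'cV[int]_d,
        conjugate_via R (Sigma N) (mul_ca_rat N (alpha z n))
          (Xspace n) (tile_shift z) (tess n)].
Proof.
move=> N nA N'; split=> [|z|z]; first exact: inverse_maps_tess_diag.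
  apply: conjugate_via_tess (multiplies_alpha_mx n_gt0 A_row z) _.
    exact: pre_mx_gt0.
  by move=> x; exact: macro_shift_tess.
apply: conjugate_via_tess (multiplies_alpha n_gt0 z) _ => // x.
exact: tess_shift.
Qed.
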